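(* The grey wolf optimizer holds order-2 stability under the stagnation assumption: for every search agent $i$ and coordinate $j$, if $x_{ij}^{(T)}(t)$, $1\le t\le T$, denotes the $j$th coordinate of the position of agent $i$ at iteration $t$ of the grey wolf optimizer with $T$ iterations in total, then the variance at the final iteration satisfies $$\lim_{T\to\infty}\mathbb{D}\,x_{ij}^{(T)}(T)=0,$$ where $\mathbb{D}$ denotes variance.
   Context: Setting: the GWO process for agent $i$ and coordinate $j$ under the stagnation assumption, i.e. the coordinates $p_{1j},p_{2j},p_{3j}\in\mathbb{R}$ of the three best search agents are constants (independent of $t$ and $T$). For each $T\ge1$, the initial value $x_{ij}^{(T)}(1)$ is uniformly distributed on the feasible interval $[l_j,r_j]$, $l_j<r_j$ (the same for all $T$), and for $1\le t<T$ $$x_{ij}^{(T)}(t+1)=\tfrac13\sum_{k=1}^3p_{kj}+\tfrac13\sum_{k=1}^3A_{kj}(t)\,|C_{kj}(t)p_{kj}-x_{ij}^{(T)}(t)|,$$ where $A_{kj}(t)\sim U[-a(t),a(t)]$, $C_{kj}(t)\sim U[0,2]$, $a(t)=2(1-t/T)$, and all variables $A_{kj}(t),C_{kj}(t)$ (over all $k,t$) are independent of each other and of the initial value. $U[p,q]$ is the uniform distribution on $[p,q]$. Order-2 stability of a meta-heuristic algorithm means that for any search agent $i$, $\mathbb{D}x_{ij}(t)\to0$ as $t\to\infty$; since the GWO runs for exactly $T$ iterations, the limit is taken at the final iteration $t=T$ as $T\to\infty$. *)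

(* Defs.v *)
From mathcomp Require Import all_boot all_order all_algebra finmap.
From mathcomp Require Import all_classical all_reals all_analysis.

Set Implicit Arguments.
Unset Strict Implicit.
Unset Printing Implicit Defensive.

Import Order.TTheory GRing.Theory Num.Theory.
Import numFieldNormedType.Exports.

Local Open Scope classical_set_scope.
Local Open Scope ring_scope.

(* [uniform_prob] is a plain set function that takes a proof of [a < b]; the two
   laws are only compared on measurable sets. *)
Definition uniformly_distributed (R : realType) (d : measure_display)
    (Omega : measurableType d) (P : probability Omega R)
    (X : {RV P >-> R}) (a b : R) : Prop :=
  exists ab : a < b, forall B : set R, measurable B ->
    distribution P X B = uniform_prob ab B.

Definition mutually_independent (R : realType) (d : measure_display)
    (Omega : measurableType d) (P : probability Omega R)
    (I : choiceType) (D : set I) (X : I -> {RV P >-> R}) : Prop :=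
  forall (J : {fset I}) (B : I -> set R),
    [set` J] `<=` D ->
    (forall i, i \in J -> measurable (B i)) ->
    P (\bigcap_(i in [set` J]) (X i @^-1` B i)) =
    (\prod_(i <- J) P (X i @^-1` B i))%E.

Definition gwo_a (R : realType) (T t : nat) : R := 2 * (1 - t%:R / T%:R).

(* [inl tt] stands for the initial value, [inr (inl (k, t))] for A_k(t) and
   [inr (inr (k, t))] for C_k(t). *)
Definition gwo_index : choiceType :=
  (unit + ('I_3 * nat + 'I_3 * nat))%type.

(* Updates happen at iterations 1 <= t < T only. *)
Definition gwo_index_set (T : nat) : set gwo_index :=
  [set s | match s with
           | inl _ => True
           | inr (inl (_, t)) | inr (inr (_, t)) => (1 <= t < T)%N
           end].

Definition gwo_source (R : realType) (d : measure_display)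
    (Omega : measurableType d) (P : probability Omega R)
    (x1 : {RV P >-> R}) (A C : 'I_3 -> nat -> {RV P >-> R})
    (s : gwo_index) : {RV P >-> R} :=
  match s with
  | inl _ => x1
  | inr (inl (k, t)) => A k t
  | inr (inr (k, t)) => C k t
  end.

(* One coordinate of one agent in a run of [T] iterations under stagnation:
   [p k] is the (constant) coordinate of the k-th best agent, [l, r] the feasible
   interval, and [x t] the coordinate at iteration [t], meaningful for
   1 <= t <= T. *)
Record gwo_process (R : realType) (d : measure_display)
    (Omega : measurableType d) (P : probability Omega R)
    (p : 'I_3 -> R) (l r : R) (T : nat)
    (A C : 'I_3 -> nat -> {RV P >-> R}) (x : nat -> {RV P >-> R}) : Prop := {
  gwo_init : uniformly_distributed (x 1%N) l r ;
  gwo_A_unif : forall k t, (1 <= t < T)%N ->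
    uniformly_distributed (A k t) (- gwo_a R T t) (gwo_a R T t) ;
  gwo_C_unif : forall k t, (1 <= t < T)%N ->
    uniformly_distributed (C k t) 0 2 ;
  gwo_indep :
    mutually_independent (gwo_index_set T) (gwo_source (x 1%N) A C) ;
  gwo_step : forall t, (1 <= t < T)%N -> forall w : Omega,
    x t.+1 w = 3^-1 * (\sum_(k < 3) p k)
             + 3^-1 * (\sum_(k < 3) A k t w * `|C k t w * p k - x t w|)
}.

(* Main.v *)
Require Import Defs.
From mathcomp Require Import all_boot all_order all_algebra finmap.
From mathcomp Require Import all_classical all_reals all_analysis.
From mathcomp Require Import measurable_realfun ess_sup_inf.
From mathcomp Require Import ring lra zify.

Set Implicit Arguments.
Unset Strict Implicit.
Unset Printing Implicit Defensive.

Import Order.TTheory GRing.Theory Num.Theory.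
Import numFieldNormedType.Exports.

Local Open Scope classical_set_scope.
Local Open Scope ring_scope.

(** The variance vanishes because the final position is almost surely squeezed
    onto one deterministic point, [m = (p 0 + p 1 + p 2) / 3], at distance [O(1 / T)].

    Since [`|A k t| <= gwo_a R T t] and [0 <= C k t <= 2] almost surely, one update gives
    [`|x (t + 1) - m| <= gwo_a R T t * (`|x t - m| + K)] with a constant [K] that depends
    on the [p k] only ([gwo_step_le], [gwo_deviation_ae]). The step sizes are
    close to 2 in the first half of the run, so the deviation may grow
    exponentially there; but it is multiplied afterwards by the small step sizes
    of the second half. Precisely, the last [n] step sizes multiply to
    [(2 / T) ^ n * n!], which is [2 / T] for [n = 1] and at most [c / T ^ 2], with
    [c] independent of [n] and [T], for [2 <= n < T] ([anneal_weight_le]). Unrolling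
    the affine recursion expresses the final deviation as a combination of these
    products with bounded coefficients: one term of order [1 / T] and fewer than
    [T] terms of order [1 / T ^ 2], hence [O(1 / T)] ([deviation_bound_le]).

    A random variable almost surely within [e] of a constant has variance at
    most [e ^ 2] ([variance_le_ae]), so the variance is [O(1 / T ^ 2)]. *)

(** * Powers against factorials *)

(** Bernoulli's inequality to second order: the first-order one only gives
    [(y + 1) ^ (y - 2) >= (2 - 2 / y) * y ^ (y - 2)], just short of the factor 2
    that [double_expn_le] asks for. *)
Lemma bernoulli2 (R : realFieldType) (h : R) (n : nat) : 0 <= h ->
  1 + n%:R * h + n%:R * (n%:R - 1) / 2 * h ^+ 2 <= (1 + h) ^+ n.
Proof.
move=> h0; elim: n => [|n IHn]; first by rewrite expr0; lra.
(* The excess of the product by [1 + h] over the next bound. *)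
have hn : 0 <= n%:R * (n%:R - 1) / 2 * h ^+ 3 :> R.
  case: n {IHn} => [|n]; first by rewrite !mul0r.
  by rewrite -[n.+1%:R]natr1 addrK !mulr_ge0 ?exprn_ge0 ?invr_ge0 ?addr_ge0.
have h1 : 0 <= 1 + h by lra.
rewrite [(1 + h) ^+ _]exprS -natr1; apply: le_trans (ler_wpM2l h1 IHn).
rewrite -subr_ge0; apply: le_trans hn _.
rewrite le_eqVlt; apply/predU1P; left; by field.
Qed.

Lemma double_expn_le (n : nat) : (6 <= n)%N ->
  (2 * n.+3 ^ n.+1 <= n.+4 ^ n.+1)%N.
Proof.
move=> n6; rewrite -(ler_nat rat) natrM !natrX.
set y : rat := n.+3%:R.
have y9 : 9 <= y by rewrite /y (ler_nat _ 9) !ltnS.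
have y0 : 0 < y by lra.
have -> : n.+4%:R = y * (1 + y^-1) :> rat.
  by rewrite mulrDr mulr1 divff ?gt_eqF// /y -natr1.
rewrite exprMn [2 * _]mulrC ler_pM2l ?exprn_gt0//.
have yV : 0 <= y^-1 by rewrite invr_ge0 ltW.
apply: le_trans (bernoulli2 n.+1 yV).
have -> : n.+1%:R = y - 2 by rewrite /y -2!natr1; lra.
have -> : 1 + (y - 2) * y^-1 + (y - 2) * (y - 2 - 1) / 2 * y^-1 ^+ 2 =
  2 + (y ^+ 2 - 9 * y + 6) / (2 * y ^+ 2) by field; lra.
rewrite lerDl divr_ge0//; nra.
Qed.

(** The value at [n = 6] of the left-hand side of [expn2_fact_le], which serves
    both as the start of the induction there and as a bound for smaller [n]. *)
Definition fact_const := (2 ^ 8 * 8`!)%N.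

(** With [m = n + 2] this says [2 ^ m * m! = O((m + 1) ^ (m - 2))]. The AM-GM
    bound [2 ^ m * m! <= (m + 1) ^ m] would be too weak: the two spare powers of
    [m + 1] are what makes a sum of [T] such terms, each divided by [T ^ m],
    vanish as [T] grows. Passing from [n] to [n + 1] multiplies the left-hand
    side by [2 * (n + 3)], and [double_expn_le] absorbs the 2 once [6 <= n]. *)
Lemma expn2_fact_le (n : nat) :
  (2 ^ n.+2 * n.+2`! <= fact_const * n.+3 ^ n)%N.
Proof.
have [n6|n6] := leqP n 6.
  apply: (@leq_trans fact_const); last by rewrite leq_pmulr// expn_gt0.
  by rewrite leq_mul ?leq_exp2l ?leq_fact// ltnS.
rewrite -(subnK (ltnW n6)); elim: (n - 6)%N => [|m IHm].
  by rewrite leq_pmulr// expn_gt0.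
set k := (m + 6)%N in IHm *; rewrite addSn -/k.
rewrite expnS factS mulnACA.
apply: leq_trans (leq_mul (leqnn _) IHm) _.
rewrite mulnCA leq_mul2l -mulnA -expnS.
by rewrite double_expn_le ?leq_addl// orbT.
Qed.

(** * The deterministic recursion *)

(** The product of the last [m] step sizes [gwo_a R T t], those with
    [T - m <= t < T], in closed form. *)
Definition anneal_weight (R : realType) (T m : nat) : R :=
  (2 / T%:R) ^+ m * m`!%:R.

(** Since [n < T], the bound [2 ^ n * n! = O((n + 1) ^ (n - 2))] is [O(T ^ (n - 2))].
    For [n = 1] the product is [2 / T], of larger order. *)
Lemma anneal_weight_le (R : realType) (T n : nat) : (1 < n < T)%N ->
  anneal_weight R T n <= fact_const%:R / T%:R ^+ 2.
Proof.
case: n => [|[|n]]// /andP[_ nT].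
have T0 : 0 < T%:R :> R by rewrite ltr0n (leq_trans _ nT).
rewrite /anneal_weight expr_div_n mulrAC ler_pdivrMr ?exprn_gt0//.
rewrite -[n.+2 in X in _ <= X]add2n exprD mulrA divfK ?gt_eqF ?exprn_gt0//.
rewrite -!natrX -!natrM ler_nat.
apply: leq_trans (expn2_fact_le n) _.
rewrite leq_mul2l; case: n nT => [|n] nT; first by rewrite orbT.
by rewrite leq_exp2r ?nT ?orbT.
Qed.

Lemma anneal_weightS (R : realType) (T m : nat) : (m < T)%N ->
  anneal_weight R T m.+1 = anneal_weight R T m * gwo_a R T (T - m.+1).
Proof.
move=> mT; have T0 : T%:R != 0 :> R by rewrite pnatr_eq0 -lt0n (leq_trans _ mT).
rewrite /anneal_weight /gwo_a natrB// exprSr factS natrM.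
by field.
Qed.

Lemma anneal_weight1 (R : realType) (T : nat) : anneal_weight R T 1 = 2 / T%:R.
Proof. by rewrite /anneal_weight expr1 mulr1. Qed.

(** Index [n] stands for iteration [n + 1]: iterations are numbered from 1, so
    that [n.+1] is also the iteration whose step size produces this value. *)
Fixpoint deviation_bound (R : realType) (T : nat) (B K : R) (n : nat) : R :=
  if n is n'.+1 then gwo_a R T n * (deviation_bound T B K n' + K) else B.

(** The step size at iteration [n + 1] is the ratio of two consecutive weights, so
    multiplying the deviation by the product of the step sizes still to come turns
    the affine recursion into a telescoping sum. *)
Lemma deviation_boundE (R : realType) (T : nat) (B K : R) (n : nat) :
  (n < T)%N ->
  anneal_weight R T (T.-1 - n) * deviation_bound T B K n =
  anneal_weight R T T.-1 * B + K * \sum_(i < n) anneal_weight R T (T.-1 - i).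
Proof.
elim: n => [|n IHn] nT; first by rewrite subn0 big_ord0 mulr0 addr0.
rewrite big_ord_recr/= [K * _]mulrDr addrA -IHn ?(ltnW nT)//.
have -> : (T.-1 - n = (T.-1 - n.+1).+1)%N by lia.
rewrite anneal_weightS; last by lia.
have -> : (T - (T.-1 - n.+1).+1 = n.+1)%N by lia.
ring.
Qed.

(** In the closed form at the final iteration, the weight of the last step alone
    is [2 / T], and the other [T - 2] weights in the sum, like the weight of the
    initial deviation, are [O(1 / T ^ 2)]. *)
Lemma deviation_bound_le (R : realType) (T : nat) (B K : R) :
  (2 < T)%N -> 0 <= B -> 0 <= K ->
  deviation_bound T B K T.-1 <=
  (fact_const%:R * (B + K) + 2 * K) / T%:R.
Proof.
move=> T2 B0 K0.
have T0 : 0 < T%:R :> R by rewrite ltr0n (leq_trans _ T2).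
have T1 : 1 <= T%:R :> R by rewrite (ler_nat _ 1) (leq_trans _ T2).
set c : R := fact_const%:R; have c0 : 0 <= c by [].
have := @deviation_boundE R T B K T.-1; rewrite subnn /anneal_weight mul1r mul1r.
move=> ->; last by lia.
rewrite -/(anneal_weight R T T.-1).
have sumle : \sum_(i < T.-1) anneal_weight R T (T.-1 - i) <= (c + 2) / T%:R.
  have -> : T.-1 = T.-2.+1 by lia.
  (* The last index is the weight of the last step, the only large one. *)
  rewrite big_ord_recr/= subSnn anneal_weight1 [(c + 2) / _]mulrDl lerD2r.
  apply: (@le_trans _ _ (\sum_(i < T.-2) c / T%:R ^+ 2)).
    by apply: ler_sum => i _; apply: anneal_weight_le; have := ltn_ord i; lia.
  rewrite sumr_const card_ord -[X in X <= _]mulr_natr.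
  have : T.-2%:R <= T%:R :> R by rewrite ler_nat; lia.
  have cT : 0 <= c / T%:R ^+ 2 by rewrite divr_ge0 ?exprn_ge0.
  move=> /(ler_wpM2l cT) /le_trans; apply.
  rewrite le_eqVlt; apply/predU1P; left; field; lra.
have wle : anneal_weight R T T.-1 <= c / T%:R.
  apply: (le_trans (@anneal_weight_le R T T.-1 _)); first by lia.
  by rewrite ler_wpM2l// lef_pV2 ?posrE ?exprn_gt0// ler_eXnr.
apply: (le_trans (lerD (ler_wpM2r B0 wle) (ler_wpM2l K0 sumle))).
rewrite le_eqVlt; apply/predU1P; left; field; lra.
Qed.

(** * Almost sure bounds and the variance *)

Lemma uniformly_distributed_ae (R : realType) (d : measure_display)
    (Omega : measurableType d) (P : probability Omega R) (X : {RV P >-> R})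
    (a b : R) :
  uniformly_distributed X a b -> {ae P, forall w, a <= X w <= b}.
Proof.
move=> [ab /(_ `[a, b]%classic (measurable_itv _))].
rewrite /uniform_prob (integral_uniform_pdf1 ab)// => PX.
have mX : measurable (X @^-1` `[a, b]) by exact: measurable_funPTI.
exists (~` (X @^-1` `[a, b])); split.
- exact: measurableC.
- have := probability_setC P mX.
  by rewrite [X in (1 - X)%E]PX subee.
- by move=> w/=; rewrite in_itv.
Qed.

(** A random variable almost surely within [e] of a constant is square
    integrable, and its variance is at most its second moment about that
    constant. *)
Lemma variance_le_ae (R : realType) (d : measure_display)
    (Omega : measurableType d) (P : probability Omega R) (X : {RV P >-> R})
    (m e : R) :
  {ae P, forall w, `|X w - m| <= e} -> ('V_P[X] <= (e ^+ 2)%:E)%E.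
Proof.
move=> Xe.
have Pfin : P [set: Omega] \is a fin_num by exact: fin_num_measure.
pose Y : Omega -> R := X \- cst m.
have mY : measurable_fun [set: Omega] Y by exact: measurable_funB.
have Y2 : Y \in Lfun P 2%:E.
  apply: (@Lfun_subset _ _ _ P 2%:E +oo%E) => //; rewrite ?lee_fin ?ler1n ?leey//.
  rewrite inE; apply/andP; split; rewrite inE//=.
  rewrite /finite_norm unlock /Lnorm; case: ifPn => // _.
  by apply: (@le_lt_trans _ _ e%:E); rewrite ?ltry//; apply/ess_supP; apply: filterS Xe.
have X2 : (X : Omega -> R) \in Lfun P 2%:E.
  have -> : (X : Omega -> R) = Y \+ cst m by apply/funext => w /=; rewrite subrK.
  by rewrite rpredD ?lee1n//= => _; exact: Lfun_cst.
rewrite -(varianceB_cst_r m X2) -/Y varianceE//.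
rewrite -(expectation_cst P (e ^+ 2)).
apply: (@le_trans _ _ ('E_P[Y ^+ 2])%E).
  by rewrite leeBlDr ?leeDl ?sqre_ge0// fin_numX// expectation_fin_num// Lfun_subset12.
apply: expectation_le => //.
- by move=> w; exact: sqr_ge0.
- by move=> w; exact: sqr_ge0.
- apply: filterS Xe => w h; change ((X w - m) ^+ 2 <= e ^+ 2).
  rewrite -[leLHS]real_normK ?num_real//.
  by rewrite ler_pXn2r ?nnegrE// (le_trans _ h).
Qed.

Definition gwo_center (R : realType) (p : 'I_3 -> R) : R :=
  3^-1 * \sum_(k < 3) p k.

(** The mean over [k] of [2 * `|p k| + `|gwo_center p|], which bounds the distance
    from the centre to [C k * p k] when [`|C k| <= 2]. *)
Definition gwo_drift (R : realType) (p : 'I_3 -> R) : R :=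
  `|gwo_center p| + 2 / 3 * \sum_(k < 3) `|p k|.

(** The left-hand side is the distance to the centre after an update from
    position [y]; the triangle inequality through the centre bounds each term. *)
Lemma gwo_step_le (R : realType) (p A C : 'I_3 -> R) (a y : R) :
  (forall k, `|A k| <= a) -> (forall k, `|C k| <= 2) ->
  `|3^-1 * \sum_(k < 3) A k * `|C k * p k - y| | <=
    a * (`|y - gwo_center p| + gwo_drift p).
Proof.
move=> hA hC; set m := gwo_center p.
have a0 : 0 <= a by apply: le_trans (hA ord0).
have term k : `|A k * `|C k * p k - y| | <= a * (2 * `|p k| + `|m| + `|y - m|).
  rewrite normrM normr_id ler_pM//.
  have -> : C k * p k - y = C k * p k - m - (y - m) by ring.
  apply: le_trans (ler_normB _ _) _; rewrite lerD2r.
  apply: le_trans (ler_normB _ _) _; rewrite lerD2r normrM.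
  by rewrite ler_wpM2r.
rewrite normrM ger0_norm ?invr_ge0//.
apply: (@le_trans _ _ (3^-1 *
    \sum_(k < 3) a * (2 * `|p k| + `|m| + `|y - m|))).
  rewrite ler_wpM2l ?invr_ge0//; apply: le_trans (ler_norm_sum _ _ _) _.
  by apply: ler_sum => k _; exact: term.
rewrite -mulr_sumr !big_split/= -mulr_sumr !sumr_const card_ord /gwo_drift -/m.
rewrite le_eqVlt; apply/predU1P; left; by field.
Qed.

(** Each update adds only finitely many null events, those where some [A k] or
    [C k] leaves its range; outside of them [gwo_step_le] applies pointwise. *)
Lemma gwo_deviation_ae (R : realType) (d : measure_display)
    (Omega : measurableType d) (P : probability Omega R)
    (p : 'I_3 -> R) (l r : R) (T : nat)
    (A C : 'I_3 -> nat -> {RV P >-> R}) (x : nat -> {RV P >-> R}) :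
  gwo_process p l r T A C x ->
  forall n, (n < T)%N ->
  {ae P, forall w, `|x n.+1 w - gwo_center p| <=
    deviation_bound T (`|l| + `|r| + `|gwo_center p|) (gwo_drift p) n}.
Proof.
move=> gwo; elim=> [|n IHn] nT.
  apply: filterS (uniformly_distributed_ae (gwo_init gwo)) => w /andP[lx xr].
  apply: le_trans (ler_normB _ _) _; rewrite lerD2r.
  rewrite ler_norml; apply/andP; split.
    by have := ler_norm (- l); rewrite normrN; have := normr_ge0 r; lra.
  by have := ler_norm r; have := normr_ge0 l; lra.
have tT : (1 <= n.+1 < T)%N by [].
have aeA : {ae P, forall w, forall k, `|A k n.+1 w| <= gwo_a R T n.+1}.
  apply: filter_forall => k.
  apply: filterS (uniformly_distributed_ae (gwo_A_unif gwo k tT)) => w.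
  by rewrite ler_norml.
have aeC : {ae P, forall w, forall k, `|C k n.+1 w| <= 2}.
  apply: filter_forall => k.
  apply: filterS (uniformly_distributed_ae (gwo_C_unif gwo k tT)) => w.
  by rewrite ler_norml => /andP[C0 ->]; rewrite andbT (le_trans _ C0)// oppr_le0.
apply: filterS3 aeA aeC (IHn (ltnW nT)) => w hA hC hx.
rewrite (gwo_step gwo tT) -/(gwo_center p) addrAC subrr add0r.
apply: (le_trans (gwo_step_le p _ hA hC)).
rewrite ler_wpM2l ?lerD2r//.
by rewrite (le_trans _ (hA ord0)).
Qed.

Theorem proposition3p5 (R : realType) (N D : nat)
  (l r : 'I_D -> R) (hlr : forall j, l j < r j)
  (p : 'I_3 -> 'I_D -> R)
  (d : nat -> measure_display)
  (Omega : forall T : nat, measurableType (d T))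
  (P : forall T : nat, probability (Omega T) R)
  (A C : forall T : nat, 'I_N -> 'I_D -> 'I_3 -> nat -> {RV (P T) >-> R})
  (x : forall T : nat, 'I_N -> 'I_D -> nat -> {RV (P T) >-> R})
  (hgwo : forall (T : nat) (i : 'I_N) (j : 'I_D), (1 <= T)%N ->
    gwo_process (p^~ j) (l j) (r j) T (A T i j) (C T i j) (x T i j)) :
  forall (i : 'I_N) (j : 'I_D),
    'V_(P T)[x T i j T] @[T --> \oo] --> 0%E.
Proof.
move=> i j.
set m := gwo_center (p^~ j).
set K : R := gwo_drift (p^~ j).
set B : R := `|l j| + `|r j| + `|m|.
set c : R := fact_const%:R * (B + K) + 2 * K.
have K0 : 0 <= K by rewrite addr_ge0// mulr_ge0// sumr_ge0.
have B0 : 0 <= B by rewrite !addr_ge0.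
apply: (@squeeze_cvge _ _ _ _ (cst 0%E) _ (fun T : nat => ((c / T%:R) ^+ 2)%:E)).
- near=> T; apply/andP; split; first exact: variance_ge0.
  have T2 : (2 < T)%N by near: T; exact: nbhs_infty_gt.
  apply: (@variance_le_ae _ _ _ _ _ m).
  have T0 : (0 < T)%N by lia.
  have := gwo_deviation_ae (hgwo T i j T0) (n := T.-1).
  rewrite prednK// => /(_ (leqnn _)); apply: filterS => w /le_trans; apply.
  exact: deviation_bound_le.
- exact: cvg_cst.
- apply/cvg_EFin; first exact: nearW.
  have invT : (T%:R^-1 : R) @[T --> \oo] --> (0 : R).
    apply/gtr0_cvgV0; last exact: cvgr_idn.
    by near=> T; rewrite ltr0n; near: T; exact: nbhs_infty_gt.
  have -> : 0 = (c * 0) * (c * 0) :> R by rewrite !mulr0.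
  by apply: cvgM; apply: cvgM => //; exact: cvg_cst.
Unshelve. all: by end_near. Qed.
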